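(* Let $n\ge 1$. There are $n$ coins, each of which has one of three possible weights $w_1<w_2<w_3$, and it is known that exactly one coin has the middle weight $w_2$. The balance scale allows any number of coins on each pan. Then there is a strategy that sorts the coins in at most $n$ weighings.
   Context: The coins are labelled and look identical; the assignment of the weights $w_1<w_2<w_3$ to the coins is unknown (subject to the stated constraint), and the numerical values of the weights are unknown. A weighing on a balance scale with huge pans (pans of unlimited capacity) compares two disjoint sets of coins, one on each pan, and reports whether the total weights are equal, the left pan is lighter, or the left pan is heavier. A strategy is adaptive: each weighing may depend on the outcomes of the previous ones. To sort the coins means to determine the partition of the coins into groups such that coins in the same group weigh the same, coins in different groups have different weights, and for every two groups it is known which one contains the lighter coins. A strategy sorts the coins in at most $m$ weighings if, for all weights $w_1<w_2<w_3$ and every admissible assignment of them to the coins, it uses at most $m$ weighings and its outcomes determine the sorting. *)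

(* Defs.v *)
From mathcomp Require Import all_boot all_order all_algebra.
From mathcomp Require Import reals.

Set Implicit Arguments.
Unset Strict Implicit.
Unset Printing Implicit Defensive.

Import Order.TTheory GRing.Theory Num.Theory.
Local Open Scope ring_scope.

Inductive outcome := Balanced | LeftLighter | LeftHeavier.

(* Adaptive strategies for [n] coins as decision trees: the next step depends
   only on the outcomes seen so far. A leaf announces the sorting as the list
   of groups, from the lightest to the heaviest. *)
Inductive strategy (n : nat) : Type :=
| Answer (gs : seq {set 'I_n})
| Weigh (A B : {set 'I_n}) (dAB : [disjoint A & B])
        (next : outcome -> strategy n).

Section Coins.
Variables (R : realType) (n : nat).
Implicit Types (w : 'I_n -> R) (S : strategy n) (A B G H : {set 'I_n}).

Definition weigh w A B : outcome :=
  let a := \sum_(i in A) w i in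
  let b := \sum_(i in B) w i in
  if a < b then LeftLighter else if b < a then LeftHeavier else Balanced.

Fixpoint num_weighings w S : nat :=
  match S with
  | Answer _ => 0
  | @Weigh _ A B _ next => (num_weighings w (next (weigh w A B))).+1
  end.

Fixpoint answer w S : seq {set 'I_n} :=
  match S with
  | Answer gs => gs
  | @Weigh _ A B _ next => answer w (next (weigh w A B))
  end.

Definition lighter_group w : rel {set 'I_n} :=
  fun G H => [forall i in G, forall j in H, w i < w j].

Definition is_sorting w (gs : seq {set 'I_n}) : Prop :=
  [/\ partition [set G in gs] [set: 'I_n],
      forall G, G \in gs -> {in G &, forall i j, w i = w j}
    & pairwise (lighter_group w) gs].

(* The values [w1] and [w3] need not both occur. *)
Definition one_middle_coin (w1 w2 w3 : R) w : Prop :=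
  (forall i, w i \in [:: w1; w2; w3]) /\ #|[set i | w i == w2]| = 1%N.

Definition sorts_in_at_most S (m : nat) : Prop :=
  forall (w1 w2 w3 : R) w, w1 < w2 -> w2 < w3 -> one_middle_coin w1 w2 w3 w ->
    (num_weighings w S <= m)%N /\ is_sorting w (answer w S).

End Coins.

Arguments sorts_in_at_most R {n} S m.

(* Main.v *)
(* All weighings compare one coin with one coin or two coins with two coins.
   Label light, middle and heavy coins 0, 1, 2: since only one coin has label 1,
   comparing sums of labels predicts such weighings whatever the weights are.

   If a light coin l and a heavy coin h are known, two further coins a, b cost
   two weighings: a + b against l + h, then a against b, leave a single
   possibility. A last coin costs one weighing against l: if it is heavier, it
   is the middle coin exactly when no other coin is. So it remains to reach such
   a pair l, h without wasting a weighing. Compare the first coin with the others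
   until they differ. If this takes several weighings, the equal coins are all
   light or all heavy, and there is one weighing to spare. If the first two coins
   p < q already differ, there is again one to spare; weigh p + q against pairs
   a + b, then a against b. In both situations, either the outcomes identify both
   coins of the new pair and keep the spare weighing, or spending it reveals a
   light and a heavy coin. *)
Require Import Defs.
From mathcomp Require Import all_boot all_order all_algebra.
From mathcomp Require Import boolp reals.
From mathcomp Require Import zify lra.

Set Implicit Arguments.
Unset Strict Implicit.
Unset Printing Implicit Defensive.

(** * Labelings and abstract weighing plans *)

Section Plans.
Variable n : nat.

Record labeling := Labeling {
  label :> 'I_n -> 'I_3;
  middle : 'I_n;
  middleP : forall i, (label i == 1 :> nat) = (i == middle) }.

Implicit Types (k : labeling) (P Q : labeling -> Prop) (a b c d i j : 'I_n).
Implicit Types (U : seq 'I_n).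

Lemma middle_uniq k i j : i != j -> ~~ ((k i == 1 :> nat) && (k j == 1 :> nat)).
Proof. by apply: contra; rewrite !middleP => /andP[/eqP -> /eqP ->]. Qed.

(* [plan P m]: if the labeling is known to satisfy [P], then [m] more weighings
   suffice to sort the coins. *)
Inductive plan : (labeling -> Prop) -> nat -> Prop :=
| plan_done P m of
    (forall k k', P k -> P k' -> forall i j, (k i < k j) = (k' i < k' j)) :
    plan P m
| plan_weigh1 a c P m of a != c
    & plan (fun k => P k /\ k a < k c) m
    & plan (fun k => P k /\ k a = k c :> nat) m
    & plan (fun k => P k /\ k c < k a) m : plan P m.+1
| plan_weigh2 a b c d P m of uniq [:: a; b; c; d]
    & plan (fun k => P k /\ k a + k b < k c + k d) m
    & plan (fun k => P k /\ k a + k b = k c + k d) m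
    & plan (fun k => P k /\ k c + k d < k a + k b) m : plan P m.+1.

Lemma plan_sub P Q m m' :
  (forall k, Q k -> P k) -> m <= m' -> plan P m -> plan Q m'.
Proof.
move=> QP le_mm' plP; elim: plP Q m' QP le_mm' => {P m}.
- by move=> P m PE Q m' QP _; apply: plan_done => k k' /QP Pk /QP Pk'; apply: PE.
- move=> a c P m ac _ IHl _ IHe _ IHg Q [|m'] QP // le_mm'.
  by apply: (plan_weigh1 ac); [apply: IHl|apply: IHe|apply: IHg] => // k [/QP].
- move=> a b c d P m abcd _ IHl _ IHe _ IHg Q [|m'] QP // le_mm'.
  by apply: (plan_weigh2 abcd); [apply: IHl|apply: IHe|apply: IHg] => // k [/QP].
Qed.

(** * Exchanging light and heavy coins *)

Fact mirrorP k i : (rev_ord (k i) == 1 :> nat) = (i == middle k).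
Proof. by rewrite -middleP /=; have := ltn_ord (k i); lia. Qed.

Definition mirror k := Labeling (mirrorP k).

Lemma mirrorE k i : mirror k i = 2 - k i :> nat.
Proof. by []. Qed.

Definition mirrored P k := exists2 k0, P k0 & forall i, k i = mirror k0 i :> nat.

(** Mirroring reverses each comparison, since both pans hold equally many coins; the two unbalanced
    branches are exchanged. *)
Lemma plan_preim_mirror P m : plan P m -> plan (fun k => P (mirror k)) m.
Proof.
elim=> {P m}.
- move=> P m PE; apply: plan_done => k k' Pk Pk' i j.
  have := PE _ _ Pk Pk' j i; rewrite !mirrorE.
  have := (ltn_ord (k i), ltn_ord (k j), ltn_ord (k' i), ltn_ord (k' j)).
  by move=> [[[]]]; lia.
- move=> a c P m ac _ IHl _ IHe _ IHg.
  apply: (plan_weigh1 ac); [apply: plan_sub IHg|apply: plan_sub IHe|apply: plan_sub IHl]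
    => // k [Pk H]; split=> //;
  rewrite !mirrorE; have := ltn_ord (k a); have := ltn_ord (k c); lia.
- move=> a b c d P m abcd _ IHl _ IHe _ IHg.
  apply: (plan_weigh2 abcd); [apply: plan_sub IHg|apply: plan_sub IHe|apply: plan_sub IHl]
    => // k [Pk H]; split=> //;
  rewrite !mirrorE; have := ltn_ord (k a); have := ltn_ord (k b);
  have := ltn_ord (k c); have := ltn_ord (k d); lia.
Qed.

Lemma plan_mirrored P m : plan (mirrored P) m -> plan P m.
Proof. by move/plan_preim_mirror; apply: plan_sub => // k Pk; exists k. Qed.

(** * Coins of known label *)

Definition known_off P U :=
  forall k k', P k -> P k' -> forall i, i \notin U -> k i = k' i :> nat.

Lemma known_off_mirrored P U : known_off P U -> known_off (mirrored P) U.
Proof.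
move=> PU k k' [k0 Pk0 E] [k0' Pk0' E'] i iU.
by rewrite E E' !mirrorE (PU _ _ Pk0 Pk0').
Qed.

Lemma label_middle k : k (middle k) = 1 :> nat.
Proof. by apply/eqP; rewrite middleP. Qed.

(** A middle coin outside [U] is the same for both labelings. So the known labels tell, without a
    weighing, whether the middle coin is still among the unknown ones. *)
Lemma has_middle k k' U : (forall i, i \notin U -> k i = k' i :> nat) ->
  has (fun i => k i == 1 :> nat) U = has (fun i => k' i == 1 :> nat) U.
Proof.
have hasE k1 : has (fun i => k1 i == 1 :> nat) U = (middle k1 \in U).
  by rewrite -has_pred1; apply: eq_has => i; apply: middleP.
move=> kk'; rewrite !hasE.
have [kU|kU] := boolP (middle k \in U); last first.
  have /eqP := kk' _ kU; rewrite label_middle eq_sym middleP => /eqP <-.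
  exact/esym/negbTE.
apply/esym; apply: contraTT kU => kU.
have /eqP := kk' _ kU; rewrite label_middle middleP => /eqP <-.
exact: kU.
Qed.

Lemma plan_known P m : known_off P [::] -> plan P m.
Proof.
by move=> PE; apply: plan_done => k k' Pk Pk' i j; rewrite !(PE _ _ Pk Pk').
Qed.

(** * Tactics for enumerating labels *)

Local Ltac distinct_coins :=
  repeat match goal with
  | H : is_true (uniq (_ :: _)) |- _ => move: H; rewrite /= ?inE ?negb_or; move=> H
  | H : is_true (_ && _) |- _ => case/andP: H => ? ?
  | H : is_true (_ \notin _ :: _) |- _ =>
      move: H; rewrite inE negb_or => H
  end;
  rewrite /= ?inE ?negb_or;
  repeat (apply/andP; split); first [done | by rewrite eq_sym].

Local Ltac label_facts :=
  repeat match goal with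
  | H : _ /\ _ |- _ => case: H => ? ?
  | H : is_true (uniq (_ :: _)) |- _ => move: H; rewrite /= ?inE ?negb_or; move=> H
  | H : is_true (_ && _) |- _ => case/andP: H => ? ?
  end;
  repeat match goal with
  | H : forall k, ?P k -> _, Hk : ?P ?k |- _ =>
      let T := type of (H k Hk) in
      lazymatch goal with _ : T |- _ => fail | _ => have ? := H k Hk end
  | k : labeling, x : 'I_n |- _ =>
      let T := type of (ltn_ord (label k x)) in
      lazymatch goal with _ : T |- _ => fail
      | _ => have ? := ltn_ord (label k x) end
  | k : labeling, H : is_true (?x != ?y) |- _ =>
      let T := type of (middle_uniq k H) in
      lazymatch goal with _ : T |- _ => fail
      | _ => have ? := middle_uniq k H end
  end;
  repeat match goal with H : _ /\ _ |- _ => case: H => ? ? end.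

Local Ltac label_cases :=
  label_facts;
  repeat match goal with
  | k : labeling, H : is_true (nat_of_ord (label ?k ?x) < 3) |- _ =>
      revert H;
      repeat match goal with H : context [label k x] |- _ => revert H end;
      generalize (nat_of_ord (label k x));
      case=> [|[|[|?]]] /=; intros; try discriminate
  end;
  try done.

Local Ltac by_labels := move=> ? ?; label_cases.

Local Ltac split_coin i a :=
  have [?|?] := eqVneq i a; [subst i|].

Local Ltac by_known_off PU :=
  apply: PU; rewrite ?inE ?negb_or; repeat (apply/andP; split); assumption.

(* [a], [b], [c], [d] are the coins not covered by [PU], padded by repetition. *)
Local Ltac known_off_cases PU a b c d :=
  let i := fresh "i" in
  move=> ? ? ? ? i; rewrite ?inE ?negb_or => ?; label_facts;
  (split_coin i a; [|split_coin i b; [|split_coin i c; [|split_coin i d;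
    [|by_known_off PU]]]]);
  clear PU; label_cases.

(** For the last coins: besides the outcomes, [has_middle] helps to separate labels 1 and 2. *)
Local Ltac known_last_cases PU a b c d :=
  apply: plan_known;
  let i := fresh "i" in
  let k := fresh "k" in
  let k' := fresh "k'" in
  let Pk := fresh "Pk" in
  let Pk' := fresh "Pk'" in
  move=> k k' Pk Pk' i _; label_facts;
  match goal with Pk : ?P k, Pk' : ?P k' |- _ =>
    have /= ? := has_middle (PU _ _ Pk Pk') end;
  (split_coin i a; [|split_coin i b; [|split_coin i c; [|split_coin i d;
    [|by_known_off PU]]]]);
  clear PU; label_cases.

(** * Plans from a known light coin and a non-light one *)

Lemma plan_both_extremes U l h P : uniq [:: l, h & U] ->
  (forall k, P k -> k l = 0 :> nat /\ k h = 2 :> nat) ->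
  known_off P U -> plan P (size U).
Proof.
have [m] := ubnP (size U); elim: m => // m IHm in U l h P *.
case: U => [|a [|b U]] ltUm uU Plh PU /=.
- exact: plan_known.
- have al : a != l by distinct_coins.
  by apply: (plan_weigh1 al); known_last_cases PU a a a a.
- have ablh : uniq [:: a; b; l; h] by distinct_coins.
  have ab : a != b by distinct_coins.
  (* Since [l + h] has label sum 2 and two middle coins are impossible, the labels of [a], [b] are
     among 00, 01, 10, or 02, 20, or 12, 21, 22; comparing [a] with [b] singles out one. *)
  by apply: (plan_weigh2 ablh); apply: (plan_weigh1 ab);
    (apply: (IHm _ l h);
      [exact: ltnW|distinct_coins|by_labels|known_off_cases PU a b b b]).
Qed.

Lemma plan_light_and_nonlight U l c P : uniq [:: l, c & U] ->
  (forall k, P k -> k l = 0 :> nat /\ 0 < k c) ->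
  known_off P (c :: U) -> plan P (size U).+1.
Proof.
have [m] := ubnP (size U); elim: m => // m IHm in U l c P *.
case: U => [|a [|b U]] ltUm uU Plc PU /=.
- known_last_cases PU c c c c.
- have ac : a != c by distinct_coins.
  have al : a != l by distinct_coins.
  apply: (plan_weigh1 ac).
  (* The labels of [a], [c] are 01, 02 or 12: [l] isolates the last, [has_middle] separates the
     others. *)
  + by apply: (plan_weigh1 al); known_last_cases PU a c c c.
  + known_last_cases PU a c c c.
  + known_last_cases PU a c c c.
- have ablc : uniq [:: a; b; l; c] by distinct_coins.
  have ab : a != b by distinct_coins.
  have ca : c != a by distinct_coins.
  have al : a != l by distinct_coins.
  have bl : b != l by distinct_coins.
  have nonlight_heavy Q : (forall k, Q k -> k l = 0 :> nat /\ k c = 2 :> nat) ->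
      known_off Q U -> plan Q (size U).+1.
    move=> Qlc QU; apply: (plan_sub (fun k Qk => Qk) (leqnSn _)).
    by apply: plan_both_extremes Qlc QU; distinct_coins.
  apply: (plan_weigh2 ablc); apply: (plan_weigh1 ab).
  + by apply: nonlight_heavy; [by_labels|known_off_cases PU a b c c].
  (* Both [a] and [b] are light and [c] is still ambiguous: the spare weighing is kept. *)
  + apply: (IHm _ l c); [exact: ltnW|distinct_coins|by_labels|].
    by known_off_cases PU a b b b.
  + by apply: nonlight_heavy; [by_labels|known_off_cases PU a b c c].
  + by apply: nonlight_heavy; [by_labels|known_off_cases PU a b c c].
  + by apply: nonlight_heavy; [by_labels|known_off_cases PU a b c c].
  + by apply: nonlight_heavy; [by_labels|known_off_cases PU a b c c].
  (* In the last three branches one of [a], [b] is surely heavy, and the spare weighing decides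
     between the two remaining possibilities. *)
  + by apply: (plan_weigh1 al); (apply: (@plan_both_extremes U l b);
      [distinct_coins|by_labels|known_off_cases PU a b c c]).
  + by apply: (plan_weigh1 ca); (apply: (@plan_both_extremes U l a);
      [distinct_coins|by_labels|known_off_cases PU a b c c]).
  + by apply: (plan_weigh1 bl); (apply: (@plan_both_extremes U l a);
      [distinct_coins|by_labels|known_off_cases PU a b c c]).
Qed.

(** * Plans from two coins of different weights *)

(** The last two hypotheses continue the only branches where [p] and [q] may stay ambiguous beyond
    one weighing: [a] and [b] both light or both heavy. *)
Lemma plan_unequal_pair_step U p q a b P : uniq [:: p, q, a, b & U] ->
  (forall k, P k -> k p < k q) -> known_off P [:: p, q, a, b & U] ->
  (forall Q, (forall k, Q k -> P k /\ (k a = 0 :> nat /\ k b = 0 :> nat)) ->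
    known_off Q [:: p, q & U] -> plan Q (size U).+1) ->
  (forall Q, (forall k, Q k -> P k /\ (k a = 2 :> nat /\ k b = 2 :> nat)) ->
    known_off Q [:: p, q & U] -> plan Q (size U).+1) ->
  plan P (size U).+3.
Proof.
move=> uU Ppq PU light heavy.
have abpq : uniq [:: a; b; p; q] by distinct_coins.
have ab : a != b by distinct_coins.
have pa : p != a by distinct_coins.
have pb : p != b by distinct_coins.
have extremes_pq Q : (forall k, Q k -> k p = 0 :> nat /\ k q = 2 :> nat) ->
    known_off Q U -> plan Q (size U).+1.
  move=> Qpq QU; apply: (plan_sub (fun k Qk => Qk) (leqnSn _)).
  by apply: plan_both_extremes Qpq QU; distinct_coins.
apply: (plan_weigh2 abpq); apply: (plan_weigh1 ab).
(* The labels of [p], [q], [a], [b] are 0201 or 1202: [a] is light, [q] is heavy, and [p] against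
   [a] tells which. *)
- by apply: (plan_weigh1 pa); (apply: (@plan_both_extremes U a q);
    [distinct_coins|by_labels|known_off_cases PU a b p q]).
- apply: light; last by known_off_cases PU a b a b.
  by move=> k [[Pk ?] ?]; split=> //; label_cases.
- by apply: (plan_weigh1 pb); (apply: (@plan_both_extremes U b q);
    [distinct_coins|by_labels|known_off_cases PU a b p q]).
(* A balance at label sum 1 or 3 would need two middle coins, so [p] is light and [q] heavy; [a] and
   [b] cannot then be equal. *)
- by apply: extremes_pq; [by_labels|known_off_cases PU a b p q].
- by apply: extremes_pq; [by_labels|known_off_cases PU a b p q].
- by apply: extremes_pq; [by_labels|known_off_cases PU a b p q].
- by apply: (plan_weigh1 pa); (apply: (@plan_both_extremes U p b);
    [distinct_coins|by_labels|known_off_cases PU a b p q]).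
- apply: heavy; last by known_off_cases PU a b a b.
  by move=> k [[Pk ?] ?]; split=> //; label_cases.
- by apply: (plan_weigh1 pb); (apply: (@plan_both_extremes U p a);
    [distinct_coins|by_labels|known_off_cases PU a b p q]).
Qed.

Lemma plan_light_and_unequal_pair U l p q P : uniq [:: l, p, q & U] ->
  (forall k, P k -> k l = 0 :> nat /\ k p < k q) ->
  known_off P [:: p, q & U] -> plan P (size U).+1.
Proof.
have [m] := ubnP (size U); elim: m => // m IHm in U l p q P *.
case: U => [|a [|b U]] ltUm uU Plpq PU /=.
- have pl : p != l by distinct_coins.
  by apply: (plan_weigh1 pl); known_last_cases PU p q p q.
- have aq : a != q by distinct_coins.
  have ap : a != p by distinct_coins.
  apply: (plan_weigh1 aq).
  + by apply: (plan_weigh1 ap); known_last_cases PU p q a a.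
  + known_last_cases PU p q a a.
  + known_last_cases PU p q a a.
- apply: (@plan_unequal_pair_step U p q a b) PU _ _; first by distinct_coins.
  + by_labels.
  + move=> Q QP QU; apply: (IHm _ l p q) QU; [exact: ltnW|by distinct_coins|].
    by move=> k /QP[Pk ?]; label_cases.
  + move=> Q QP QU.
    have QP' k : Q k -> P k by move/QP => [].
    (* With [l] light and [a] heavy, the label sum 2 separates the pairs 01, 02 and 12 for [p],
       [q]. *)
    have pqla : uniq [:: p; q; l; a] by distinct_coins.
    by apply: (plan_weigh2 pqla); (apply: (@plan_both_extremes U l a);
      [distinct_coins|by_labels|known_off_cases QU p q p q]).
Qed.

Lemma plan_unequal_pair U p q P : uniq [:: p, q & U] ->
  (forall i, i \in [:: p, q & U]) ->
  (forall k, P k -> k p < k q) -> plan P (size U).+1.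
Proof.
move=> uU allU Ppq.
have PU : known_off P [:: p, q & U] by move=> k k' _ _ i; rewrite allU.
case: U => [|a [|b U]] in uU allU PU *.
(* Two coins are sorted by their order alone, although their labels may be 01 or 12. *)
- apply: plan_done => k k' /Ppq ltpq /Ppq ltpq' i j.
  by move: (allU i) (allU j); rewrite !inE => /orP[] /eqP-> /orP[] /eqP->; lia.
- have aq : a != q by distinct_coins.
  have ap : a != p by distinct_coins.
  apply: (plan_weigh1 aq).
  + by apply: (plan_weigh1 ap); known_last_cases PU p q a a.
  + known_last_cases PU p q a a.
  + known_last_cases PU p q a a.
- apply: (@plan_unequal_pair_step U p q a b) PU _ _; [by distinct_coins|by []| |].
  + move=> Q QP QU; apply: (@plan_light_and_unequal_pair U a p q) QU.
      by distinct_coins.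
    by move=> k /QP[Pk ?]; label_cases.
  (* Mirroring makes the heavy coin [a] light and reverses the order of [p] and [q]. *)
  + move=> Q QP /known_off_mirrored QU; apply: plan_mirrored.
    apply: (@plan_light_and_unequal_pair U a q p).
    * by distinct_coins.
    * by move=> k [k0 /QP[Pk0 ?] E]; rewrite !E !mirrorE; label_cases.
    * move=> k k' Qk Qk' i iU; apply: QU => //; move: iU.
      by rewrite !inE !negb_or => /and3P[-> -> ->].
Qed.

(** * An initial run of equal coins, and the full plan *)

(** As [r] and [s] agree, neither is the middle coin; the first coin differing from them shows
    whether they are light or heavy. *)
Lemma plan_equal_but U r s P : uniq [:: r, s & U] ->
  (forall k, P k -> forall i, i \notin U -> k i = k r :> nat) ->
  plan P (size U).+1.
Proof.
elim: U P => [|a U IHU] P uU PE.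
  (* If all coins agreed with [r], the middle coin would too, and so would [s]: no labeling
     satisfies [P]. *)
  apply: plan_done => k k' Pk _.
  have rs : r != s by distinct_coins.
  have := middle_uniq k rs.
  have := PE k Pk (middle k) isT; have := PE k Pk s isT.
  by rewrite label_middle => -> <-.
have ra : r != a by distinct_coins.
have rs : r != s by distinct_coins.
have sU : s \notin a :: U by case/and3P: uU.
have Prs k : P k -> k s = k r :> nat by move=> Pk; apply: PE.
have PU k k' : P k -> P k' -> k r = k' r :> nat ->
    forall i, i \notin a :: U -> k i = k' i :> nat.
  by move=> Pk Pk' E i iU; rewrite (PE k) // (PE k').
apply: (plan_weigh1 ra).
- apply: (@plan_light_and_nonlight U r a); [by distinct_coins|by_labels|].
  move=> k k' [Pk lt_ra] [Pk' lt_ra']; apply: PU => //.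
  by label_cases.
- apply: IHU; first by distinct_coins.
  move=> k [Pk E] i iU; have [->//|ia] := eqVneq i a.
  by apply: PE; rewrite // inE negb_or ia.
- apply/plan_mirrored/(@plan_light_and_nonlight U r a); first by distinct_coins.
    by move=> k [k0 [Pk0 ?] E]; rewrite !E !mirrorE; label_cases.
  apply: known_off_mirrored => k k' [Pk lt_ra] [Pk' lt_ra']; apply: PU => //.
  by label_cases.
Qed.

Lemma plan_all : 0 < n -> plan (fun _ => True) n.
Proof.
move=> n_gt0; have := enum_uniq 'I_n; have := mem_enum 'I_n.
have := size_enum_ord n.
case: (enum _) => [|r [|p U]] /= sizeU allU uU; first by rewrite -sizeU in n_gt0.
  apply: plan_done => k k' _ _ i j.
  by move: (allU i) (allU j); rewrite !inE => /eqP-> /eqP->; rewrite !ltnn.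
rewrite -[in plan _ n]sizeU.
have rp : r != p by distinct_coins.
apply: (plan_weigh1 rp).
- by apply: (@plan_unequal_pair U r p) => // k [].
- apply: (@plan_equal_but U r p) => // k [_ E] i iU.
  by have := allU i; rewrite !inE (negPf iU) orbF => /orP[] /eqP->.
- apply: (@plan_unequal_pair U p r); first by distinct_coins.
    by move=> i; have := allU i; rewrite !inE orbCA.
  by move=> k [].
Qed.

End Plans.

(** * From labels to weights *)

Import Order.TTheory GRing.Theory Num.Theory.
Local Open Scope ring_scope.

Definition weight_of (F : numDomainType) (w1 w2 w3 : F) (v : nat) : F :=
  if v is v'.+1 then (if v' is 0 then w2 else w3) else w1.

(* A single middle coin never balances against a mixture of light and heavy
   coins, so adding up the labels predicts every weighing of two against two. *)
Lemma weight_of_lt2 (F : realFieldType) (w1 w2 w3 : F) (x y z t : nat) :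
  w1 < w2 -> w2 < w3 -> (x < 3)%N -> (y < 3)%N -> (z < 3)%N -> (t < 3)%N ->
  (count (pred1 1%N) [:: x; y; z; t] <= 1)%N ->
  let W := weight_of w1 w2 w3 in
  (W x + W y < W z + W t) = (x + y < z + t)%N.
Proof.
move=> lt12 lt23.
case: x => [|[|[|?]]] // _; case: y => [|[|[|?]]] // _;
case: z => [|[|[|?]]] // _; case: t => [|[|[|?]]] //= _ _;
by first [refine (_ : is_true _); lra | apply/negbTE; rewrite -leNgt; lra].
Qed.

(** * From plans to strategies *)

Section Soundness.
Variables (R : realType) (n : nat).
Implicit Types (w : 'I_n -> R) (k : labeling n).

(** Empty levels are removed because a weight may be absent and a partition has no empty block. *)
Lemma is_sorting_levels w (h : 'I_n -> nat) (m : nat) :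
  (forall i, (h i < m)%N) -> (forall i j, (w i < w j) = (h i < h j)%N) ->
  is_sorting w [seq G <- [seq [set i | h i == v] | v <- iota 0 m] | G != set0].
Proof.
move=> ltm wh; split.
- apply/and3P; split.
  + rewrite eqEsubset subsetT; apply/subsetP => i _.
    apply/bigcupP; exists [set j | h j == h i]; last by rewrite inE.
    rewrite inE mem_filter; apply/andP; split.
      by apply/set0Pn; exists i; rewrite inE.
    by apply/mapP; exists (h i); rewrite // mem_iota /= add0n.
  + apply/trivIsetP => G H; rewrite !inE !mem_filter.
    move=> /andP[_ /mapP[v _ ->]] /andP[_ /mapP[v' _ ->]] neq.
    rewrite disjoint_subset; apply/subsetP => i; rewrite !inE => /eqP hi.
    by apply: contraNneq neq => hi'; rewrite -hi -hi'.
  + by rewrite inE mem_filter eqxx.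
- move=> G; rewrite mem_filter => /andP[_ /mapP[v _ ->]] i j.
  rewrite !inE => /eqP hi /eqP hj; apply/le_anti.
  by rewrite !leNgt !wh hi hj ltnn.
- apply: pairwise_filter; rewrite pairwise_map.
  have := iota_ltn_sorted 0 m; rewrite sorted_pairwise; last exact: ltn_trans.
  apply: sub_pairwise => u v ltuv; apply/forallP => i; apply/implyP.
  rewrite inE => /eqP hi; apply/forallP => j; apply/implyP.
  by rewrite inE wh hi => /eqP->.
Qed.

Definition realizes (w1 w2 w3 : R) k w :=
  [/\ w1 < w2, w2 < w3 & forall i, w i = weight_of w1 w2 w3 (k i)].

Definition compare_nat (x y : nat) : outcome :=
  if (x < y)%N then LeftLighter else if (y < x)%N then LeftHeavier else Balanced.

Lemma realizes_lt (w1 w2 w3 : R) k w : realizes w1 w2 w3 k w ->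
  forall i j, (w i < w j) = (k i < k j)%N.
Proof.
move=> [lt12 lt23 wk] i j; rewrite !wk; have lt13 := lt_trans lt12 lt23.
by case: (k i) (k j) => [[|[|[|?]]] ?] // [[|[|[|?]]] ?] //=;
  rewrite ?ltxx ?lt12 ?lt23 ?lt13 //; apply/negbTE; rewrite -leNgt ltW.
Qed.

Lemma weigh1E (w1 w2 w3 : R) k w a c : realizes w1 w2 w3 k w ->
  weigh w [set a] [set c] = compare_nat (k a) (k c).
Proof. by move=> wk; rewrite /weigh !big_set1 !(realizes_lt wk). Qed.

Lemma realizes_lt2 (w1 w2 w3 : R) k w a b c d : realizes w1 w2 w3 k w ->
  uniq [:: a; b; c; d] ->
  (w a + w b < w c + w d) = (k a + k b < k c + k d)%N.
Proof.
move=> [lt12 lt23 wk] uabcd; rewrite !wk weight_of_lt2 ?ltn_ord //.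
(* Counting labels 1 among distinct coins counts occurrences of the middle coin, at most one. *)
have -> : count (pred1 1%N) [:: k a : nat; k b : nat; k c : nat; k d : nat] =
    count (pred1 (middle k)) [:: a; b; c; d] by rewrite /= !middleP.
by rewrite count_uniq_mem //; case: (_ \in _).
Qed.

Lemma weigh2E (w1 w2 w3 : R) k w a b c d : realizes w1 w2 w3 k w ->
  uniq [:: a; b; c; d] ->
  weigh w [set a; b] [set c; d] = compare_nat (k a + k b) (k c + k d).
Proof.
move=> wk uabcd; rewrite /compare_nat -(realizes_lt2 wk uabcd).
rewrite -(realizes_lt2 wk); last first.
  by rewrite -[uniq _]/(uniq ([:: c; d] ++ [:: a; b])) uniq_catC.
move: uabcd; rewrite /= !inE !negb_or => /and4P[/and3P[ab _ _] _ cd _].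
by rewrite /weigh !big_setU1 ?inE // !big_set1.
Qed.

Lemma plan_strategy (P : labeling n -> Prop) m : plan P m ->
  exists S : strategy n, forall (w1 w2 w3 : R) k w, realizes w1 w2 w3 k w -> P k ->
    (num_weighings w S <= m)%N /\ is_sorting w (answer w S).
Proof.
elim=> {P m}.
(* If no labeling satisfies [P], any answer will do. Otherwise every such labeling orders the coins
   as [k0] does, so the levels of [k0] are announced. *)
- move=> P m PE; have [[k0 Pk0]|nP] := pselect (exists k, P k); last first.
    by exists (Answer [::]) => w1 w2 w3 k w _ Pk; case: nP; exists k.
  exists (Answer [seq G <- [seq [set i | k0 i == v :> nat] | v <- iota 0 3]
                 | G != set0]).
  move=> w1 w2 w3 k w wk Pk; split; first by [].
  apply: (@is_sorting_levels _ (fun i => k0 i)) => [i|i j]; first exact: ltn_ord.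
  by rewrite (realizes_lt wk) (PE _ _ Pk Pk0).
- move=> a c P m ac _ [Sl SlP] _ [Se SeP] _ [Sg SgP].
  have dac : [disjoint [set a] & [set c]] by rewrite disjoints1 inE.
  exists (Weigh dac (fun o => match o with
    Balanced => Se | LeftLighter => Sl | LeftHeavier => Sg end)).
  move=> w1 w2 w3 k w wk Pk /=; rewrite (weigh1E _ _ wk) ltnS /compare_nat.
  by case: ltngtP => cmp; [apply: SlP wk _|apply: SgP wk _|apply: SeP wk _].
- move=> a b c d P m uabcd _ [Sl SlP] _ [Se SeP] _ [Sg SgP].
  have dabcd : [disjoint [set a; b] & [set c; d]].
    rewrite disjoints_subset; apply/subsetP => i; rewrite !inE.
    move: uabcd; rewrite /= !inE !negb_or.
    by case/and4P=> /and3P[_ ac ad] /andP[bc bd] _ _ /orP[] /eqP->; apply/andP.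
  exists (Weigh dabcd (fun o => match o with
    Balanced => Se | LeftLighter => Sl | LeftHeavier => Sg end)).
  move=> w1 w2 w3 k w wk Pk /=; rewrite (weigh2E wk uabcd) ltnS /compare_nat.
  by case: ltngtP => cmp; [apply: SlP wk _|apply: SgP wk _|apply: SeP wk _].
Qed.

End Soundness.

Theorem theorem5p2 (R : realType) (n : nat) (hn : (1 <= n)%N) :
  exists S : strategy n, sorts_in_at_most R S n.
Proof.
have [S SP] := plan_strategy R (plan_all hn).
exists S => w1 w2 w3 w lt12 lt23 [w123 /eqP/cards1P[m mE]].
(* The final default stands for [w3], the only remaining weight. *)
pose lab (i : 'I_n) : 'I_3 :=
  if w i == w1 then inord 0 else if w i == w2 then inord 1 else inord 2.
have lt13 := lt_trans lt12 lt23.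
have labP i : (lab i == 1 :> nat) = (i == m).
  have := in_set1 i m; rewrite -mE inE => <-; rewrite /lab.
  have [->|_] := eqVneq (w i) w1; first by rewrite inordK ?lt_eqF.
  by case: ifP; rewrite inordK.
apply: (SP w1 w2 w3 (Labeling labP)) => //; split=> // i.
rewrite /= /lab; have := w123 i; rewrite !inE.
have [->|_] /= := eqVneq (w i) w1; first by rewrite inordK.
by have [->|_] /= := eqVneq (w i) w2; rewrite inordK // => /eqP.
Qed.
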